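(* The subspace of the operad $\operatorname{PreLie}$ spanned by the labeled rooted trees that are not corollas is an (operadic) ideal.
   Context: Operads are symmetric operads in $\mathbb{Q}$-vector spaces. $\operatorname{PreLie}(n)$ (for $n\ge1$; $\operatorname{PreLie}(0)=0$) is the vector space with basis the rooted trees whose vertices are labeled bijectively by $\{1,\dots,n\}$, with $\mathfrak{S}_n$ acting by relabeling. Edges are oriented towards the root. For labeled rooted trees $T$, $S$ on vertex sets $I$, $J$ and $i\in I$, the composition of $S$ at the vertex $i$ of $T$ is $$T\circ_i S=\sum_f T\circ_i^f S,$$ a sum over all maps $f$ from the set of incoming edges of the vertex $i$ of $T$ to the set of vertices of $S$, where $T\circ_i^f S$ is obtained by replacing the vertex $i$ by the tree $S$ and grafting back the subtrees of $T$ previously attached to $i$ according to the map $f$ (with the usual relabeling when $I=\{1,\dots,m\}$, $J=\{1,\dots,n\}$). The unit is the tree with one vertex. The depth of a rooted tree is the maximum number of vertices in a chain of adjacent vertices starting from the root. A corolla is a rooted tree of depth at most two. *)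

(* Defs.v *)
(* Mathematical Components. *)
From HB Require Import structures.
From mathcomp Require Import all_boot all_order all_algebra all_fingroup.
From mathcomp Require Import zify.

Set Implicit Arguments.
Unset Strict Implicit.
Unset Printing Implicit Defensive.

Import GRing.Theory.
Local Open Scope ring_scope.

(* Symmetric operads in Q-vector spaces (finite-dimensional in each arity),    *)
(* presented by partial compositions.  Only the operations are recorded: the   *)
(* notion of ideal does not refer to the operad axioms.                        *)
Record operad_data := OperadData {
  op_space : nat -> vectType rat;
  op_act : forall n, 'S_n -> op_space n -> op_space n;
  op_one : op_space 1;
  op_comp : forall m n, 'I_m -> op_space m -> op_space n -> op_space (m + n).-1
}.

Definition operad_ideal (P : operad_data)
    (J : forall n, {vspace op_space P n}) : Prop :=
  [/\ forall n (s : 'S_n) (x : op_space P n), x \in J n -> op_act s x \in J n,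
      forall m n (i : 'I_m) (x : op_space P m) (y : op_space P n),
        x \in J m -> op_comp i x y \in J (m + n).-1
    & forall m n (i : 'I_m) (x : op_space P m) (y : op_space P n),
        y \in J n -> op_comp i x y \in J (m + n).-1].
Arguments operad_ideal : clear implicits.

(* A rooted tree with vertex set V is encoded by its parent function: edges    *)
(* point from a vertex to its parent, the root is the only vertex without a    *)
(* parent, and every vertex is joined to the root by a path of edges.  There   *)
(* is no such tree when V is empty.                                            *)
Definition is_rtree (V : finType) (p : {ffun V -> option V}) : bool :=
  [exists r, (p r == None) &&
             [forall v, connect (fun x y => p x == Some y) v r]].

Record rtree (V : finType) := RTree {
  parent :> {ffun V -> option V};
  rtreeP : is_rtree parent
}.

HB.instance Definition _ (V : finType) := [isSub for @parent V].
HB.instance Definition _ (V : finType) := [Finite of rtree V by <:].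

Definition adjacent (V : finType) (T : rtree V) : rel V :=
  fun x y => (T x == Some y) || (T y == Some x).

Definition root_chain (V : finType) (T : rtree V) (s : seq V) : bool :=
  if s is r :: s' then [&& T r == None, path (adjacent T) r s' & uniq s]
  else false.

Definition depth (V : finType) (T : rtree V) : nat :=
  \max_(k < #|V|.+1 | [exists t : k.-tuple V, root_chain T t]) k.

Definition corolla (V : finType) (T : rtree V) : bool := (depth T <= 2)%N.

Section Relabel.
Variables (A B : finType) (h : A -> B).

Definition relabel_parent (T : rtree A) : {ffun B -> option B} :=
  [ffun b => if [pick a | h a == b] is Some a then omap h (T a) else None].

Hypothesis h_bij : bijective h.

Lemma relabel_parentE (T : rtree A) a :
  relabel_parent T (h a) = omap h (T a).
Proof.
rewrite ffunE; case: pickP => [a' /eqP/(bij_inj h_bij)-> //|/(_ a)].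
by rewrite eqxx.
Qed.

Lemma relabel_is_rtree (T : rtree A) : is_rtree (relabel_parent T).
Proof.
have [r /andP[/eqP Tr /forallP rP]] := existsP (rtreeP T).
apply/existsP; exists (h r); rewrite relabel_parentE Tr eqxx /=.
apply/forallP => b; case: (h_bij) => h' _ h'K; rewrite -(h'K b).
have /connectP[p] := rP (h' b); elim: p (h' b) => [|y p IHp] a /=.
  by move=> _ <-; apply: connect0.
move=> /andP[/eqP Tay pathp] rE; apply: connect_trans (IHp y pathp rE).
by apply: connect1; rewrite relabel_parentE Tay.
Qed.

Definition relabel (T : rtree A) : rtree B := RTree (relabel_is_rtree T).

End Relabel.

Section Graft.
Variables (A B : finType) (T : rtree A) (i : A) (S : rtree B).

(* An incoming edge of i is identified with the child it comes from. *)
Definition in_edge : finType := {c : A | T c == Some i}.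

(* The vertex set of the composite is the disjoint union of A \ {i} and B. *)
Definition comp_vertex : finType := ({x : A | x != i} + B)%type.

Definition from_T (x : option A) : option comp_vertex :=
  obind (fun y => omap inl (insub y)) x.

Variable f : {ffun in_edge -> B}.

(* In both uses of from_T below its argument is never [Some i]. *)
Definition graft_parent : {ffun comp_vertex -> option comp_vertex} :=
  [ffun v : comp_vertex => match v with
    | inl x => if insub (val x) is Some e then Some (inr (f e))
               else from_T (T (val x))
    | inr b => if S b is Some b' then Some (inr b') else from_T (T i)
    end].

Lemma rtree_irrefl x : T x != Some x.
Proof.
apply/negP => /eqP Txx; have [r /andP[/eqP Tr /forallP/(_ x)/connectP[p]]] :=
  existsP (rtreeP T).
elim: p => [_ /= rx|y p IHp /= /andP[]]; first by rewrite rx Txx in Tr.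
by rewrite Txx => /eqP[<-].
Qed.

Lemma graft_is_rtree : is_rtree graft_parent.
Proof.
have [r /andP[/eqP Tr /forallP rP]] := existsP (rtreeP T).
have [q /andP[/eqP Sq /forallP qP]] := existsP (rtreeP S).
pose phi (a : A) : comp_vertex := if insub a is Some x then inl x else inr q.
have phi_i : phi i = inr q by rewrite /phi insubF // eqxx.
have phiN a (ai : a != i) : phi a = inl (Sub a ai) by rewrite /phi insubT.
have from_TN a (ai : a != i) : from_T (Some a) = Some (phi a).
  by rewrite /from_T /= insubT phiN.
pose e : rel comp_vertex := fun x y => graft_parent x == Some y.
have conB b : connect e (inr b) (inr q).
  have /connectP[p] := qP b; elim: p b => [|y p IHp] b /=.
    by move=> _ <-; apply: connect0.
  move=> /andP[/eqP Sby pathp] qE; apply: connect_trans (IHp y pathp qE).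
  by apply: connect1; rewrite /e ffunE Sby.
have conT a b : T a = Some b -> connect e (phi a) (phi b).
  move=> Tab; have [ai|ai] := eqVneq a i.
    have bi : b != i.
      apply/negP => /eqP bi; have := rtree_irrefl i.
      by rewrite -[in T i]ai Tab bi eqxx.
    by rewrite ai phi_i; apply: connect1; rewrite /e ffunE Sq -ai Tab from_TN.
  have [bi|bi] := eqVneq b i.
    rewrite bi phi_i; have Tai : T a == Some i by rewrite Tab bi.
    apply: connect_trans (conB (f (Sub a Tai))).
    by apply: connect1; rewrite /e ffunE (phiN _ ai) /= insubT.
  apply: connect1; rewrite /e (phiN _ ai) ffunE /= insubF ?Tab ?from_TN //.
  by apply: contraNF bi => /eqP[->].
have conA a : connect e (phi a) (phi r).
  have /connectP[p] := rP a; elim: p a => [|y p IHp] a /=.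
    by move=> _ <-; apply: connect0.
  move=> /andP[/eqP Tay pathp] rE; apply: connect_trans (IHp y pathp rE).
  exact: conT.
apply/existsP; exists (phi r); apply/andP; split.
  have [ri|ri] := eqVneq r i; first by rewrite ri phi_i ffunE Sq -ri Tr.
  by rewrite (phiN _ ri) ffunE /= insubF Tr.
apply/forallP => -[[x xi]|b].
  by have := conA x; rewrite (phiN _ xi).
by apply: connect_trans (conB b) _; rewrite -phi_i.
Qed.

Definition graft : rtree comp_vertex := RTree graft_is_rtree.

End Graft.

(* Usual relabeling for the composition at i (labels start from 0): the labels *)
(* of T below i are kept, those of S are shifted by i, and those of T above i  *)
(* are shifted by n - 1.                                                       *)
Definition comp_label_nat m n (i : 'I_m) (v : comp_vertex 'I_n i) : nat :=
  match v with
  | inl x => if (val x < i)%N then val x : nat else (val x + n).-1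
  | inr k => (i + k)%N
  end.

Lemma comp_label_subproof m n (i : 'I_m) (v : comp_vertex 'I_n i) :
  (comp_label_nat v < (m + n).-1)%N.
Proof.
have lim := ltn_ord i.
case: v => [[x /= xi]|k] /=; last by have := ltn_ord k; lia.
have lxm := ltn_ord x; move: xi; rewrite -val_eqE /=.
by case: (ltnP x i); lia.
Qed.

Definition comp_label m n (i : 'I_m) (v : comp_vertex 'I_n i) :
  'I_(m + n).-1 := Ordinal (comp_label_subproof v).

Lemma comp_label_bij m n (i : 'I_m) : bijective (@comp_label m n i).
Proof.
apply: inj_card_bij => [v w /(congr1 val) /=|]; last first.
  rewrite card_sum card_sig !card_ord; have := cardC1 i; rewrite card_ord.
  rewrite (eq_card (B := [pred x | x != i])) => [->|//].
  by have := ltn_ord i; lia.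
case: v w => [[x xi]|k] [[y yi]|l] /=.
- have xi' : val x != val i by rewrite val_eqE.
  have yi' : val y != val i by rewrite val_eqE.
  move=> /= E.
  congr inl; apply: val_inj; apply: val_inj => /=.
  by move: E xi' yi' => /=; case: (ltnP x i); case: (ltnP y i); lia.
- have xi' : val x != val i by rewrite val_eqE.
  have := ltn_ord l.
  by move: xi' => /=; case: (ltnP x i); lia.
- have yi' : val y != val i by rewrite val_eqE.
  have := ltn_ord k.
  by move: yi' => /=; case: (ltnP y i); lia.
- by move=> E; congr inr; apply: val_inj => /=; lia.
Qed.

Definition tree_comp m n (i : 'I_m) (T : rtree 'I_m) (S : rtree 'I_n)
    (f : {ffun in_edge T i -> 'I_n}) : rtree 'I_(m + n).-1 :=
  relabel (@comp_label_bij m n i) (graft S f).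

Lemma tree_unit_subproof : is_rtree [ffun _ : 'I_1 => None].
Proof.
apply/existsP; exists ord0; rewrite ffunE eqxx.
by apply/forallP => v; rewrite (ord1 v) connect0.
Qed.

Definition tree_unit : rtree 'I_1 := RTree tree_unit_subproof.

Definition prelie_space (n : nat) : vectType rat :=
  {ffun rtree 'I_n -> rat^o}.

Definition tree_vec n (T : rtree 'I_n) : prelie_space n :=
  [ffun U => (U == T)%:R].

Definition perm_bij n (s : 'S_n) : bijective s :=
  Bijective (permK s) (permKV s).

Definition prelie_act n (s : 'S_n) (x : prelie_space n) : prelie_space n :=
  \sum_(T : rtree 'I_n) x T *: tree_vec (relabel (perm_bij s) T).

Definition prelie_comp m n (i : 'I_m) (x : prelie_space m)
    (y : prelie_space n) : prelie_space (m + n).-1 :=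
  \sum_(T : rtree 'I_m) \sum_(S : rtree 'I_n) (x T * y S) *:
    \sum_(f : {ffun in_edge T i -> 'I_n}) tree_vec (tree_comp S f).

Definition PreLie : operad_data :=
  OperadData prelie_act (tree_vec tree_unit) prelie_comp.

Definition noncorolla_span (n : nat) : {vspace op_space PreLie n} :=
  <<[seq tree_vec T | T : rtree 'I_n in [pred U | ~~ corolla U]]>>%VS.

(* Main.v *)
Require Import Defs.
From mathcomp Require Import all_boot all_order all_algebra all_fingroup.

Set Implicit Arguments.
Unset Strict Implicit.
Unset Printing Implicit Defensive.

Import GRing.Theory.
Local Open Scope ring_scope.

(** A rooted tree is not a corolla exactly when some vertex has a grandparent
    ([noncorollaP]), and having a grandparent somewhere survives every operation
    of the operad.  Relabeling carries the parent function along a bijection.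
    In a composite of [T] and [S] at a vertex [i], the tree [S] sits unchanged,
    so a grandparent in [S] is still one there ([noncorolla_graft_inner]).  For
    [T] one contracts [S] back onto [i] ([contract]): an edge of [T] lifts to an
    edge of the composite, and any vertex lying over a vertex of [T] which has a
    parent again has a parent, whatever the grafting map is
    ([noncorolla_graft_outer]).  So all the trees that occur in a composite are
    noncorollas as soon as one of the two factors is, and the statement about
    subspaces follows by bilinearity: an element of the span has zero coefficient
    on every corolla ([noncorolla_span_coef]), hence only noncorollas contribute
    to the sums that define the action and the composition. *)

Definition has_grandparent (V : finType) (T : rtree V) : Prop :=
  exists a b, T a = Some b /\ T b != None.

(** Going up through the ancestors of a vertex that has a grandparent, one ends
    at a vertex whose grandparent is the root.  The depth only looks at chains
    that start at the root, and this is where one of three vertices is found. *)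
Lemma root_is_grandparent (V : finType) (T : rtree V) : has_grandparent T ->
  exists a b c, [/\ T a = Some b, T b = Some c & T c = None].
Proof.
move=> [a [b [Tab Tb]]].
have [r /andP[/eqP Tr /forallP/(_ a)/connectP[p]]] := existsP (rtreeP T).
elim: p a b Tab Tb => [a b Tab _ _ /= ra|y p IHp a b Tab Tb /=].
  by rewrite -ra Tr in Tab.
rewrite Tab => /andP[/eqP[<-] pathp] rE.
case Tbc: (T b) Tb => [c|//] _; case Tc: (T c) => [d|]; last by exists a, b, c.
by apply: (IHp b c) => //; rewrite Tc.
Qed.

Lemma noncorollaP (V : finType) (T : rtree V) :
  ~~ corolla T <-> has_grandparent T.
Proof.
rewrite /corolla -ltnNge; split=> [depthT|].
  have /exists_inP[k /existsP[[s /= /eqP sz_s] chain] k2] :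
      [exists (k : 'I_#|V|.+1 | [exists t : k.-tuple V, root_chain T t]),
        2 < k]%N.
    apply: contraLR depthT; rewrite negb_exists_in -leqNgt => /forall_inP small.
    by apply/bigmax_leqP => k /small; rewrite -leqNgt.
  case: s sz_s chain => [|r [|x [|y s]]] /= sz_s; try by rewrite -sz_s in k2.
  rewrite /adjacent !inE !negb_or => /and3P[/eqP Tr /and3P[Trx Txy _] uniqs].
  (* The second step of the chain cannot go back to the root. *)
  move: Trx Txy uniqs; rewrite Tr /= => /eqP Tx; rewrite Tx.
  case/orP=> [/eqP[->]|/eqP Ty _]; first by rewrite eqxx andbF.
  by exists y, x; rewrite Ty Tx.
move=> /root_is_grandparent[a [b [c [Tab Tbc Tc]]]].
have uniq_cba : uniq [:: c; b; a].
  rewrite /= !inE negb_or !andbT -andbA; apply/and3P; split.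
  - by apply/eqP => cb; rewrite cb Tbc in Tc.
  - by apply/eqP => ca; rewrite ca Tab in Tc.
  - by apply/eqP => ba; have := rtree_irrefl T a; rewrite Tab ba eqxx.
have card3 : (3 < #|V|.+1)%N.
  by rewrite ltnS -[X in (X <= _)%N](card_uniqP uniq_cba) max_card.
apply: (@bigmax_sup _ (Ordinal card3)) => //.
apply/existsP; exists [tuple c; b; a].
apply/and3P; split; [by rewrite Tc | | exact: uniq_cba].
by rewrite /= /adjacent Tbc Tab !eqxx !orbT.
Qed.

Lemma noncorolla_relabel (A B : finType) (h : A -> B) (h_bij : bijective h)
    (T : rtree A) :
  ~~ corolla T -> ~~ corolla (relabel h_bij T).
Proof.
rewrite !noncorollaP => -[a [b [Tab Tb]]]; exists (h a), (h b).
by rewrite /= !relabel_parentE // Tab; case: (T b) Tb.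
Qed.

Lemma noncorolla_graft_inner (A B : finType) (T : rtree A) (i : A)
    (S : rtree B) (f : {ffun in_edge T i -> B}) :
  ~~ corolla S -> ~~ corolla (graft S f).
Proof.
rewrite !noncorollaP => -[a [b [Sab Sb]]]; exists (inr a), (inr b).
by rewrite /= !ffunE Sab; case: (S b) Sb.
Qed.

Lemma from_T_neq (A B : finType) (i x : A) (xi : x != i) :
  from_T B i (Some x) = Some (inl (Sub x xi)).
Proof. by rewrite /from_T /= insubT. Qed.

Definition contract (A B : finType) (i : A) (v : comp_vertex B i) : A :=
  if v is inl x then val x else i.

(** The root of [S] inherits the parent of [i], and the children of [i] are
    attached to vertices of [S]; all other vertices keep the parent they had. *)
Lemma graft_has_parent (A B : finType) (T : rtree A) (i : A) (S : rtree B)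
    (f : {ffun in_edge T i -> B}) (v : comp_vertex B i) :
  T (contract v) != None -> graft S f v != None.
Proof.
rewrite /= ffunE; case: v => [x|b] /=.
  case: insubP => [//|]; case: (T (val x)) => [y|//] yi _.
  have yi' : y != i by apply: contraNneq yi => ->.
  by rewrite from_T_neq.
case: (S b) => [//|]; case Ti: (T i) => [y|//] _.
have yi : y != i by apply: contraNneq (rtree_irrefl T i) => {2}<-; rewrite Ti.
by rewrite from_T_neq.
Qed.

(** The edge is lifted from its source: when the source is [i], the edge leaves
    [S] from the root of [S]. *)
Lemma graft_lift_edge (A B : finType) (T : rtree A) (i : A) (S : rtree B)
    (f : {ffun in_edge T i -> B}) (a b : A) :
  T a = Some b -> exists v w, graft S f v = Some w /\ contract w = b.
Proof.
move=> Tab; have [ai|ai] := eqVneq a i.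
  have bi : b != i.
    by apply: contraNneq (rtree_irrefl T a) => bi; rewrite Tab bi ai.
  have [q /andP[/eqP Sq _]] := existsP (rtreeP S).
  exists (inr q), (inl (Sub b bi)).
  by move: Tab; rewrite ai /= ffunE Sq => ->; rewrite from_T_neq.
have [bi|bi] := eqVneq b i.
  have Tai : T a == Some i by rewrite Tab bi.
  exists (inl (Sub a ai)), (inr (f (Sub a Tai))).
  by rewrite /= ffunE /= insubT.
exists (inl (Sub a ai)), (inl (Sub b bi)); rewrite /= ffunE /= insubF.
  by rewrite Tab from_T_neq.
by apply: contraNF bi; rewrite Tab => /eqP[->].
Qed.

Lemma noncorolla_graft_outer (A B : finType) (T : rtree A) (i : A)
    (S : rtree B) (f : {ffun in_edge T i -> B}) :
  ~~ corolla T -> ~~ corolla (graft S f).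
Proof.
rewrite !noncorollaP => -[a [b [Tab Tb]]].
have [v [w [vw wb]]] := graft_lift_edge S f Tab.
by exists v, w; split=> //; apply: graft_has_parent; rewrite wb.
Qed.

Lemma noncorolla_tree_comp m n (i : 'I_m) (T : rtree 'I_m) (S : rtree 'I_n)
    (f : {ffun in_edge T i -> 'I_n}) :
  ~~ corolla T || ~~ corolla S -> ~~ corolla (tree_comp S f).
Proof.
by case/orP=> ncor; apply: noncorolla_relabel;
  [apply: noncorolla_graft_outer | apply: noncorolla_graft_inner].
Qed.

Lemma tree_vec_noncorolla_span n (T : rtree 'I_n) :
  ~~ corolla T -> tree_vec T \in noncorolla_span n.
Proof. by move=> ncT; apply/memv_span/imageP; exists T. Qed.

Lemma noncorolla_span_coef n (x : prelie_space n) (T : rtree 'I_n) :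
  x \in noncorolla_span n -> corolla T -> x T = 0.
Proof.
rewrite /noncorolla_span => /(@coord_span _ _ _ (in_tuple _)) -> corT.
rewrite sum_ffunE big1 // => k _; rewrite ffunE.
have /imageP[U ncU ->] := mem_nth (0 : prelie_space n) (ltn_ord k).
rewrite ffunE; case: eqVneq => [TU|_]; last by rewrite scaler0.
by move: ncU; rewrite inE -TU corT.
Qed.

Theorem proposition8 : operad_ideal PreLie noncorolla_span.
Proof.
split=> [n s x Jx|m n i x y Jx|m n i x y Jy] /=.
- apply: memv_suml => T _.
  have [corT|ncT] := boolP (corolla T).
    by rewrite (noncorolla_span_coef Jx corT) scale0r mem0v.
  by apply/memvZ/tree_vec_noncorolla_span/noncorolla_relabel.
- apply: memv_suml => T _; apply: memv_suml => S _.
  have [corT|ncT] := boolP (corolla T).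
    by rewrite (noncorolla_span_coef Jx corT) mul0r scale0r mem0v.
  apply/memvZ/memv_suml => f _.
  by apply/tree_vec_noncorolla_span/noncorolla_tree_comp; rewrite ncT.
- apply: memv_suml => T _; apply: memv_suml => S _.
  have [corS|ncS] := boolP (corolla S).
    by rewrite (noncorolla_span_coef Jy corS) mulr0 scale0r mem0v.
  apply/memvZ/memv_suml => f _.
  by apply/tree_vec_noncorolla_span/noncorolla_tree_comp; rewrite ncS orbT.
Qed.
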